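(* Let $\Bbbk$ be a field, $W\subseteq\Bbbk^n$ a linear realization of a matroid $\mathcal M$ of rank $r$ on $[n]$, and let $\Pi$ be the partition of $[n]$ into the connected components of $\mathcal M$. Let $P=\bigoplus_{i=1}^n S\,a_i$ be the free bigraded $S$-module with basis $a_1,\dots,a_n$ in bidegree $(1,1)$, and let $K$ be the kernel of the bihomogeneous $S$-linear map $P\to\mathfrak a$, $a_i\mapsto f_ig_i$. Then: (1) $K_{(1,1)}$ is spanned over $\Bbbk$ by the sums $\sum_{i\in C}a_i$, for $C\in\Pi$; (2) if $\mathcal M$ has no loops, then $K_{(\cdot,1)}\cong\operatorname{Der}(\mathscr A)(-1)$ as graded $R$-modules; (3) if $\mathcal M$ has no coloops, then $K_{(1,\cdot)}\cong\operatorname{Der}(\mathscr A^\perp)(-1)$ as graded $R^\perp$-modules.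
   Context: A linear realization of $\mathcal M$ is an $r$-dimensional subspace $W\subseteq\Bbbk^n$ such that $W\to\Bbbk^n\to\Bbbk^B$ (coordinate projection) is an isomorphism iff $B$ is a basis of $\mathcal M$. Identify $\Bbbk^n$ with its dual via the standard basis; $W^\perp=\{y:\sum x_iy_i=0\ \forall x\in W\}$ realizes the dual matroid $\mathcal M^\perp$. $f_i\in W^*$, $g_i\in(W^\perp)^*$ are the restrictions of the $i$-th coordinate function. $R=\Bbbk[W]$, $R^\perp=\Bbbk[W^\perp]$ (standard graded polynomial rings generated by the $f_i$, resp. $g_i$), $S=R\otimes_\Bbbk R^\perp$ bigraded with $R_p\otimes R^\perp_q$ in bidegree $(p,q)$. The ideal of pairs is $\mathfrak a=(f_1g_1,\dots,f_ng_n)\subseteq S$. For a bigraded module $N$, $N_{(\cdot,1)}=\bigoplus_pN_{(p,1)}$ (an $R$-module), $N_{(1,\cdot)}=\bigoplus_qN_{(1,q)}$ (an $R^\perp$-module). If $\mathcal M$ has no loops, $\mathscr A=\{\ker f_i\}$ is the arrangement in $W$ and $\operatorname{Der}(\mathscr A)=\{\theta\in\operatorname{Der}_\Bbbk(R):\theta(f_i)\in f_iR\ \forall i\}$; if $\mathcal M$ has no coloops, $\mathscr A^\perp=\{\ker g_i\}$ in $W^\perp$ and $\operatorname{Der}(\mathscr A^\perp)$ is defined likewise using $R^\perp$ and the $g_i$. Derivations are graded so that $\theta$ has degree $d$ if it raises degrees by $d$ (coordinate partial derivatives have degree $-1$); $N(-1)_p=N_{p-1}$. *)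

(* Defs.v *)
From HB Require Import structures.
From mathcomp Require Import all_boot all_order all_algebra.
From mathcomp Require Import boolp functions.
From mathcomp Require Export mpoly.

Set Implicit Arguments.
Unset Strict Implicit.
Unset Printing Implicit Defensive.

Import GRing.Theory.
Local Open Scope ring_scope.

Record matroid (E : finType) := Matroid {
  mbases :> {set {set E}};
  mbases_neq0 : mbases != set0;
  mbases_exchange : forall B1 B2 : {set E}, B1 \in mbases -> B2 \in mbases ->
    forall x, x \in B1 :\: B2 ->
    exists2 y, y \in B2 :\: B1 & (y |: (B1 :\ x)) \in mbases }.

Section Matroid.
Variables (E : finType) (M : matroid E).

Definition mrank : nat := \max_(B in mbases M) #|B|.

Definition mindep (A : {set E}) : bool := [exists B in mbases M, A \subset B].

Definition mcircuit (C : {set E}) : bool := minset (fun A => ~~ mindep A) C.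

Definition mloop (x : E) : bool := ~~ mindep [set x].

(* A coloop is a loop of the dual matroid: an element of every basis. *)
Definition mcoloop (x : E) : bool := [forall B in mbases M, x \in B].

(* By circuit elimination this relation is transitive, so its classes form a
   partition. *)
Definition mconnected (x y : E) : bool :=
  (x == y) || [exists C : {set E}, [&& mcircuit C, x \in C & y \in C]].

Definition mcomponents : {set {set E}} :=
  equivalence_partition mconnected [set: E].

End Matroid.

Section Realization.
Variables (k : fieldType) (n : nat).
Implicit Types (W : {vspace 'rV[k]_n}) (B : {set 'I_n}).

Definition coordproj W B (x : subvs_of W) : {ffun {i : 'I_n | i \in B} -> k} :=
  [ffun i => vsval x 0 (val i)].

Definition realizes W (M : matroid 'I_n) : Prop :=
  \dim W = mrank M /\ forall B, B \in mbases M <-> bijective (@coordproj W B).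

Definition perp W : {vspace 'rV[k]_n} :=
  (\bigcap_(x <- vbasis W) lker (linfun (mulmxr x^T : 'rV[k]_n -> 'rV[k]_1)))%VS.

Lemma perpP W (y : 'rV[k]_n) :
  y \in perp W <-> (forall x, x \in W -> \sum_i x 0 i * y 0 i = 0).
Proof.
have E (x : 'rV[k]_n) : (y *m x^T == 0) = (\sum_i x 0 i * y 0 i == 0).
  apply/eqP/eqP => [/matrixP/(_ 0 0)|h].
    rewrite !mxE => h; rewrite -[RHS]h; apply: eq_bigr => i _.
    by rewrite mxE mulrC.
  apply/matrixP => i j; rewrite !ord1 !mxE -[RHS]h.
  by apply: eq_bigr => l _; rewrite mxE mulrC.
have memE (t : seq 'rV[k]_n) :
    (y \in (\bigcap_(x <- t)
       lker (linfun (mulmxr x^T : 'rV[k]_n -> 'rV[k]_1)))%VS)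
    = all (fun x : 'rV[k]_n => \sum_i x 0 i * y 0 i == 0) t.
  elim: t => [|x t IH]; first by rewrite big_nil memvf.
  by rewrite big_cons memv_cap IH memv_ker lfunE /= E.
rewrite /perp memE; split => [/allP h x xW|h]; last first.
  by apply/allP => x xb; apply/eqP/h/vbasis_mem.
rewrite (coord_vbasis xW).
under eq_bigr do rewrite summxE mulr_suml.
rewrite exchange_big big1 //= => j _.
under eq_bigr do rewrite mxE -mulrA.
rewrite -mulr_sumr (eqP (h _ _)) ?mulr0 //.
by rewrite mem_nth // size_tuple.
Qed.

(* If [b] is a basis of a subspace [W], then k[W] = Sym(W^* ) is the polynomial
   ring on the basis of W^* dual to [b]; in these variables [coordform b i] is
   the restriction to [W] of the [i]-th coordinate function. *)
Definition coordform (r : nat) (b : r.-tuple 'rV[k]_n) (i : 'I_n)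
    : {mpoly k[r]} :=
  \sum_(j < r) (tnth b j) 0 i *: 'X_j.

End Realization.

(* A grading is given by its predicates "[u] is homogeneous of degree [d]". *)
Definition graded_iso (A : nzRingType) (U V : lmodType A)
    (gU : int -> U -> Prop) (gV : int -> V -> Prop) : Prop :=
  exists phi : {linear U -> V},
    bijective phi /\ forall d u, gU d u <-> gV d (phi u).

Definition gshift (U : Type) (g : int -> U -> Prop) (a : int) : int -> U -> Prop :=
  fun d => g (d + a).

Definition restrict_scalars (A B : nzRingType) (iota : {rmorphism A -> B})
  (V : lmodType B) : Type := V.

Section RestrictScalars.
Variables (A B : nzRingType) (iota : {rmorphism A -> B}) (V : lmodType B).
Local Notation U := (restrict_scalars iota V).

HB.instance Definition _ := GRing.Zmodule.on U.

Definition restrict_scale (a : A) (v : U) : U := iota a *: (v : V).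

Lemma restrict_scaleA a b v :
  restrict_scale a (restrict_scale b v) = restrict_scale (a * b) v.
Proof. by rewrite /restrict_scale rmorphM scalerA. Qed.
Lemma restrict_scale1 : left_id 1 restrict_scale.
Proof. by move=> v; rewrite /restrict_scale rmorph1 scale1r. Qed.
Lemma restrict_scaleDr : right_distributive restrict_scale +%R.
Proof. by move=> a u v; rewrite /restrict_scale scalerDr. Qed.
Lemma restrict_scaleDl v : {morph restrict_scale^~ v : a b / a + b}.
Proof. by move=> a b; rewrite /restrict_scale rmorphD scalerDl. Qed.

HB.instance Definition _ := GRing.Zmodule_isLmodule.Build A U
  restrict_scaleA restrict_scale1 restrict_scaleDr restrict_scaleDl.

End RestrictScalars.

Section Derivations.
Variables (k : fieldType) (r n : nat) (f : 'I_n -> {mpoly k[r]}).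
Local Notation R := {mpoly k[r]}.

Definition derivation (theta : R -> R) : Prop :=
  (forall (c : k) (a b : R), theta (c *: a + b) = c *: theta a + theta b) /\
  (forall a b : R, theta (a * b) = theta a * b + a * theta b).

Definition log_derivation : {pred R -> R^o} := [pred theta : R -> R^o |
  `[< derivation theta /\ forall i, exists c : R, theta (f i) = f i * c >]].

Lemma log_derivation_submod : submod_closed log_derivation.
Proof.
split=> [|a t1 t2].
  apply/asboolP; split; last by move=> i; exists 0; rewrite mulr0.
  by split=> [c|] x y; rewrite ?scaler0 ?mul0r ?mulr0 addr0.
have tE x : (a *: t1 + t2) x = a * t1 x + t2 x by [].
move=> /asboolP[[L1 D1] T1] /asboolP[[L2 D2] T2]; apply/asboolP; split.
  split=> [c|] x y; rewrite !tE.
    by rewrite L1 L2 mulrDr -scalerAr scalerDr addrACA.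
  by rewrite D1 D2 !mulrDr !mulrDl !mulrA (mulrC x a) addrACA.
move=> i; have [c1 E1] := T1 i; have [c2 E2] := T2 i.
by exists (a * c1 + c2); rewrite tE E1 E2 mulrDr mulrCA.
Qed.

HB.instance Definition _ :=
  GRing.isSubmodClosed.Build R (R -> R^o) log_derivation log_derivation_submod.

Record Der := MkDer { der_val :> R -> R^o; _ : der_val \in log_derivation }.

HB.instance Definition _ := [isSub for der_val].
HB.instance Definition _ := [Choice of Der by <:].
HB.instance Definition _ := [SubChoice_isSubLmodule of Der by <:].

Definition homogz (e : int) (h : R) : bool :=
  all (fun m => (mdeg m)%:Z == e) (msupp h).

Definition der_deg (d : int) (theta : Der) : Prop :=
  forall (e : int) (h : R), homogz e h -> homogz (e + d) (theta h).

End Derivations.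

Section Pairs.
Variables (k : fieldType) (r s : nat).
Local Notation R := {mpoly k[r]}.
Local Notation R' := {mpoly k[s]}.
(* The tensor product of [R] and [R'] over k: the first [r] variables are those
   of [R], the last [s] those of [R']. *)
Local Notation S := {mpoly k[r + s]}.

Definition embl : {rmorphism R -> S} :=
  comp_mpoly [tuple 'X_(lshift s j) | j < r].
Definition embr : {rmorphism R' -> S} :=
  comp_mpoly [tuple 'X_(rshift r j) | j < s].

Definition mdegl (m : 'X_{1..r + s}) : nat := \sum_(j < r) m (lshift s j).
Definition mdegr (m : 'X_{1..r + s}) : nat := \sum_(j < s) m (rshift r j).

Definition bihomog (p q : int) (h : S) : bool :=
  all (fun m => ((mdegl m)%:Z == p) && ((mdegr m)%:Z == q)) (msupp h).

Lemma bihomogP p q h :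
  reflect (forall m, m \in msupp h -> (mdegl m)%:Z = p /\ (mdegr m)%:Z = q)
          (bihomog p q h).
Proof.
apply: (iffP allP) => H m /H; first by case/andP => /eqP ? /eqP ?.
by case=> -> ->; rewrite !eqxx.
Qed.

Lemma bihomog0 p q : bihomog p q 0.
Proof. by rewrite /bihomog msupp0. Qed.

Lemma bihomogD p q g h : bihomog p q g -> bihomog p q h -> bihomog p q (g + h).
Proof.
move=> /allP G /allP H; apply/allP => m /msuppD_le.
by rewrite mem_cat => /orP[/G|/H].
Qed.

Lemma bihomogZ p q (c : k) h : bihomog p q h -> bihomog p q (c *: h).
Proof. by move=> /allP H; apply/allP => m /msuppZ_le /H. Qed.

Lemma bihomogM p q p' q' g h : bihomog p q g -> bihomog p' q' h ->
  bihomog (p + p') (q + q') (g * h).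
Proof.
move=> /bihomogP G /bihomogP H; apply/bihomogP => m /msuppM_le.
case/allpairsP => -[m1 m2] /= [/G[<- <-] /H[<- <-] ->].
by rewrite /mdegl /mdegr -!PoszD -!big_split; split; congr Posz;
  apply: eq_bigr => j _; rewrite mnmDE.
Qed.

Lemma bihomogX (j : 'I_(r + s)) :
  bihomog (mdegl U_(j))%:Z (mdegr U_(j))%:Z 'X_j.
Proof. by rewrite /bihomog msuppX /= !eqxx. Qed.

Lemma bihomog_exp p q h d : bihomog p q h ->
  bihomog (p *+ d) (q *+ d) (h ^+ d).
Proof.
move=> H; elim: d => [|d IH]; last by rewrite exprS !mulrS bihomogM.
rewrite expr0 !mulr0n; apply/bihomogP => m; rewrite msupp1 inE => /eqP ->.
by rewrite /mdegl /mdegr !big1 // => i _; rewrite mnm0E.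
Qed.

Lemma bihomog_prod (I : finType) (h : I -> S) (p q : I -> int) :
  (forall i, bihomog (p i) (q i) (h i)) ->
  bihomog (\sum_i p i) (\sum_i q i) (\prod_i h i).
Proof.
move=> H; rewrite -!(big_enum_cond _ _ (fun=> true)) /=.
elim: (enum _) => [|i t IH]; last by rewrite !big_cons bihomogM.
by rewrite !big_nil -(expr0 (0 : S)) -(mulr0n (0 : int)) bihomog_exp ?bihomog0.
Qed.

Lemma bihomog_emblX m : bihomog (mdeg m)%:Z 0 (embl 'X_[m]).
Proof.
rewrite /embl /= comp_mpolyX.
suff /bihomog_prod: forall i : 'I_r, bihomog (m i)%:Z 0
    (tnth [tuple 'X_(lshift s j) | j < r] i ^+ m i : S).
  by rewrite big1_eq mdegE (big_morph Posz PoszD (erefl _)).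
move=> i; rewrite tnth_mktuple.
have := bihomog_exp (m i) (bihomogX (lshift s i)).
rewrite /mdegl /mdegr (bigD1 i) //= mnmE eqxx big1 ?addn0 => [|j ji]; last first.
  by rewrite mnmE (inj_eq (@lshift_inj _ _)) eq_sym (negPf ji).
rewrite big1 => [|j _]; last by rewrite mnmE eq_lrshift.
by rewrite mul0rn natz.
Qed.

Lemma bihomog_embrX m : bihomog 0 (mdeg m)%:Z (embr 'X_[m]).
Proof.
rewrite /embr /= comp_mpolyX.
suff /bihomog_prod: forall i : 'I_s, bihomog 0 (m i)%:Z
    (tnth [tuple 'X_(rshift r j) | j < s] i ^+ m i : S).
  by rewrite big1_eq mdegE (big_morph Posz PoszD (erefl _)).
move=> i; rewrite tnth_mktuple.
have := bihomog_exp (m i) (bihomogX (rshift r i)).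
rewrite /mdegl /mdegr big1 => [|j _]; last by rewrite mnmE eq_rlshift.
rewrite (bigD1 i) //= mnmE eqxx big1 ?addn0 => [|j ji]; last first.
  by rewrite mnmE (inj_eq (@rshift_inj _ _)) eq_sym (negPf ji).
by rewrite mul0rn natz.
Qed.

Variables (n : nat) (f : 'I_n -> R) (g : 'I_n -> R').

Local Notation P := 'rV[S]_n.

Definition pgen (i : 'I_n) : P := delta_mx 0 i.

(* Its image is the ideal of pairs, so its kernel is that of the map from P
   onto this ideal. *)
Definition pairmap (u : P) : S := \sum_i u 0 i * (embl (f i) * embr (g i)).

(* The generators [pgen i] have bidegree (1,1). *)
Definition bihomog_free (p q : int) (u : P) : Prop :=
  forall i, bihomog (p - 1) (q - 1) (u 0 i).

Definition Kbi (p q : int) (u : P) : Prop :=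
  pairmap u = 0 /\ bihomog_free p q u.

(* The sum of the K_(p,q) over all p, resp. over all q; it is direct since the
   bigraded components of P are independent. *)
Definition Kcol_pred (q : int) : {pred restrict_scalars embl P} :=
  [pred u | `[< exists2 t : seq P,
    (forall v, v \in t -> exists p, Kbi p q v) & u = \sum_(v <- t) v >]].
Definition Krow_pred (p : int) : {pred restrict_scalars embr P} :=
  [pred u | `[< exists2 t : seq P,
    (forall v, v \in t -> exists q, Kbi p q v) & u = \sum_(v <- t) v >]].

Lemma KbiM p q p' q' (a : S) (u : P) : bihomog p' q' a -> Kbi p q u ->
  Kbi (p' + p) (q' + q) (a *: u).
Proof.
move=> A [U0 U]; split.
  rewrite -[RHS](mulr0 a) -U0 mulr_sumr; apply: eq_bigr => i _.
  by rewrite mxE mulrA.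
by move=> i; rewrite mxE -!addrA bihomogM.
Qed.

Lemma KbiZ p q (c : k) (u : P) : Kbi p q u -> Kbi p q (c%:MP *: u).
Proof.
move=> [U0 U]; split.
  rewrite -[RHS](mulr0 c%:MP) -U0 mulr_sumr; apply: eq_bigr => i _.
  by rewrite mxE mulrA.
by move=> i; rewrite mxE mul_mpolyC bihomogZ.
Qed.

Lemma Kcol_submod q : submod_closed (Kcol_pred q).
Proof.
split; first by apply/asboolP; exists [::]; rewrite // big_nil.
move=> a u v /asboolP[t T ->] /asboolP[t' T' ->]; apply/asboolP.
exists ([seq (a@_m)%:MP *: (embl 'X_[m] *: x) | x <- t, m <- msupp a] ++ t').
  move=> x; rewrite mem_cat => /orP[|/T'//].
  case/allpairsP=> -[y m] /= [/T[p Hp] _ ->].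
  exists ((mdeg m)%:Z + p); apply: KbiZ; rewrite -[q]add0r.
  exact: KbiM (bihomog_emblX m) Hp.
rewrite big_cat; congr (_ + _).
rewrite big_allpairs_dep /= {1}[a]mpolyE {1}/GRing.scale /= /restrict_scale.
rewrite scaler_sumr; apply: eq_bigr => x _.
rewrite rmorph_sum scaler_suml; apply: eq_bigr => m _.
by rewrite scalerA -mul_mpolyC rmorphM /= comp_mpolyC.
Qed.

Lemma Krow_submod p : submod_closed (Krow_pred p).
Proof.
split; first by apply/asboolP; exists [::]; rewrite // big_nil.
move=> a u v /asboolP[t T ->] /asboolP[t' T' ->]; apply/asboolP.
exists ([seq (a@_m)%:MP *: (embr 'X_[m] *: x) | x <- t, m <- msupp a] ++ t').
  move=> x; rewrite mem_cat => /orP[|/T'//].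
  case/allpairsP=> -[y m] /= [/T[q Hq] _ ->].
  exists ((mdeg m)%:Z + q); apply: KbiZ; rewrite -[p]add0r.
  exact: KbiM (bihomog_embrX m) Hq.
rewrite big_cat; congr (_ + _).
rewrite big_allpairs_dep /= {1}[a]mpolyE {1}/GRing.scale /= /restrict_scale.
rewrite scaler_sumr; apply: eq_bigr => x _.
rewrite rmorph_sum scaler_suml; apply: eq_bigr => m _.
by rewrite scalerA -mul_mpolyC rmorphM /= comp_mpolyC.
Qed.

HB.instance Definition _ q := GRing.isSubmodClosed.Build R
  (restrict_scalars embl P) (Kcol_pred q) (Kcol_submod q).
HB.instance Definition _ p := GRing.isSubmodClosed.Build R'
  (restrict_scalars embr P) (Krow_pred p) (Krow_submod p).

Record Kcol (q : int) := MkKcol {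
  kcol_val :> restrict_scalars embl P; _ : kcol_val \in Kcol_pred q }.

HB.instance Definition _ q := [isSub for @kcol_val q].
HB.instance Definition _ q := [Choice of Kcol q by <:].
HB.instance Definition _ q := [SubChoice_isSubLmodule of Kcol q by <:].

Record Krow (p : int) := MkKrow {
  krow_val :> restrict_scalars embr P; _ : krow_val \in Krow_pred p }.

HB.instance Definition _ p := [isSub for @krow_val p].
HB.instance Definition _ p := [Choice of Krow p by <:].
HB.instance Definition _ p := [SubChoice_isSubLmodule of Krow p by <:].

Definition Kcol_deg (q p : int) (u : Kcol q) : Prop := Kbi p q (kcol_val u).
Definition Krow_deg (p q : int) (u : Krow p) : Prop := Kbi p q (krow_val u).

End Pairs.

(* Main.v *)
(** Since g_i = sum_l b'_l(i) Y_l, comparing coefficients of Y_l turns the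
    relation sum_i v_i f_i g_i = 0, with v_i in R, into the linear conditions
    sum_i b'_l(i) v_i f_i = 0 for all l. They say that (v_i f_i)_i lies in
    (W^perp)^perp tensored with R, that is in W tensored with R, so that
    v_i f_i = theta(f_i) for a unique derivation theta = sum_j theta_j d/dX_j;
    theta is logarithmic by construction. In degree (1,1) the v_i are constants
    c_i and the condition says that diag(c) preserves W, equivalently W^perp.
    The nonzero vectors of W^perp of minimal support are supported exactly on
    the circuits, are unique up to scaling and span W^perp, so this means that
    c is constant on every circuit. *)

From HB Require Import structures.
From mathcomp Require Import boolp.
Require Import Defs.
From mathcomp Require Import all_boot all_order all_algebra.
Import GRing.Theory.

Set Implicit Arguments.
Unset Strict Implicit.
Unset Printing Implicit Defensive.

Local Open Scope ring_scope.

(** * Circuits of a realized matroid *)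

Definition tuple_mx (k : fieldType) (n r : nat) (b : r.-tuple 'rV[k]_n) :
    'M[k]_(r, n) :=
  \matrix_(j < r) tnth b j.

Section Realization.
Variables (k : fieldType) (n : nat).

Lemma mem_tuple_mx (r : nat) (W : {vspace 'rV[k]_n}) (b : r.-tuple 'rV[k]_n) x :
  basis_of W b -> (x \in W) = (x <= tuple_mx b)%MS.
Proof.
move=> hb; apply/idP/idP => [/(coord_basis hb) ->|/submxP[D ->]].
  apply: summx_sub => j _; apply: scalemx_sub.
  by rewrite -tnth_nth -[tnth b j](rowK (tnth b)) row_sub.
rewrite mulmx_sum_row; apply: memv_suml => j _; apply: memvZ.
by rewrite rowK -(span_basis hb) memv_span // mem_tnth.
Qed.

Lemma tuple_mx_free (r : nat) (W : {vspace 'rV[k]_n}) (b : r.-tuple 'rV[k]_n) :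
  basis_of W b -> row_free (tuple_mx b).
Proof.
move=> hb; apply: inj_row_free => v v0; apply/rowP => j; rewrite mxE.
have /freeP/(_ (v 0)) := basis_free hb; apply; rewrite -[RHS]v0 mulmx_sum_row.
by apply: eq_bigr => i _; rewrite rowK -tnth_nth.
Qed.

Lemma mem_perp (r : nat) (W : {vspace 'rV[k]_n}) (b : r.-tuple 'rV[k]_n)
    (y : 'rV[k]_n) :
  basis_of W b -> (y \in perp W) = (y *m (tuple_mx b)^T == 0).
Proof.
move=> hb; apply/idP/eqP => [/perpP h|h].
  apply/rowP => j; rewrite !mxE -[RHS](h (tnth b j)).
    by apply: eq_bigr => i _; rewrite !mxE mulrC.
  by rewrite (basis_mem hb) ?mem_tnth.
apply/perpP => x; rewrite (mem_tuple_mx _ hb) => /submxP[D ->].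
have : y *m (D *m tuple_mx b)^T = 0 by rewrite trmx_mul mulmxA h mul0mx.
move/rowP/(_ 0); rewrite !mxE => e; rewrite -[RHS]e.
by apply: eq_bigr => i _; rewrite [in RHS]mxE mulrC.
Qed.

(* The blocks of two mutually inverse n x n matrices. Transposing exchanges
   [B] with [B'], so a statement about [W] yields the one about [perp W]. *)
Definition dual_frame (r s : nat) (B : 'M[k]_(r, n)) (B' : 'M[k]_(s, n)) X T :
    Prop :=
  [/\ B *m B'^T = 0, B *m X = 1%:M, B' *m T^T = 1%:M &
      1%:M = X *m B + B'^T *m T].

Lemma dual_frame_sym (r s : nat) (B : 'M[k]_(r, n)) (B' : 'M[k]_(s, n)) X T :
  dual_frame B B' X T -> dual_frame B' B T^T X^T.
Proof.
case=> h1 h2 h3 h4; split; rewrite ?trmxK //.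
  by rewrite -[B']trmxK -trmx_mul h1 trmx0.
by rewrite -trmx1 h4 linearD /= !trmx_mul trmxK addrC.
Qed.

(** [X] is a right inverse of the row-free matrix [B]. Then [Q = 1 - X B] satisfies [B Q = 0], so
    its columns lie in [perp W]. Writing [Q^T = D B'] gives [T = D^T]. *)
Lemma dual_frame_exists (r s : nat) (W : {vspace 'rV[k]_n})
    (b : r.-tuple 'rV[k]_n) (b' : s.-tuple 'rV[k]_n) :
  basis_of W b -> basis_of (perp W) b' ->
  exists X T, dual_frame (tuple_mx b) (tuple_mx b') X T.
Proof.
move=> hb hb'; set B := tuple_mx b; set B' := tuple_mx b'.
have orth : B *m B'^T = 0.
  apply/matrixP => j l; rewrite !mxE.
  have /perpP h : tnth b' l \in perp W by rewrite (basis_mem hb') ?mem_tnth.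
  rewrite -[RHS](h (tnth b j)) ?(basis_mem hb) ?mem_tnth //.
  by apply: eq_bigr => i _; rewrite !mxE.
have BX : B *m pinvmx B = 1%:M by rewrite mulmxVp // (tuple_mx_free hb).
pose Q := 1%:M - pinvmx B *m B.
have BQ : B *m Q = 0 by rewrite mulmxBr mulmx1 mulmxA BX mul1mx subrr.
have /submxP[D QD] : (Q^T <= B')%MS.
  apply/row_subP => i; rewrite -(mem_tuple_mx _ hb') (mem_perp _ hb).
  by rewrite -row_mul -trmx_mul BQ trmx0 row0.
exists (pinvmx B), D^T; split=> //; last first.
  by rewrite -trmx_mul -QD trmxK /Q addrC subrK.
(* [B' D = 1] is checked after cancelling [B'] on the right: [B' D B' = B' Q^T = B'], by
   orthogonality of [B] and [B']. *)
rewrite trmxK; apply: (row_free_inj (tuple_mx_free hb')).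
rewrite -mulmxA -QD mul1mx /Q linearB /= trmx1 mulmxBr mulmx1 trmx_mul.
by rewrite mulmxA -[B' *m _]trmxK trmx_mul trmxK orth trmx0 mul0mx subr0.
Qed.

(** By the last identity of a dual frame, [w = w X B + w B'^T T]. The hypothesis kills the second
    term, and the first lies in the row space of [B]. *)
Lemma perp_perp (W : {vspace 'rV[k]_n}) (w : 'rV[k]_n) :
  (forall y, y \in perp W -> \sum_i w 0 i * y 0 i = 0) -> w \in W.
Proof.
move=> h; have hb := vbasisP W; have hb' := vbasisP (perp W).
have [X [T [_ _ _ e]]] := dual_frame_exists hb hb'.
rewrite (mem_tuple_mx _ hb) -[w]mulmx1 e mulmxDr !mulmxA.
suff -> : w *m (tuple_mx (vbasis (perp W)))^T = 0.
  by rewrite mul0mx addr0 submxMl.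
apply/rowP => l; rewrite !mxE -[RHS](h (tnth (vbasis (perp W)) l)).
  by apply: eq_bigr => i _; rewrite !mxE.
by rewrite (basis_mem hb') ?mem_tnth.
Qed.

(** * Supports, independence and circuits *)

Definition supp (y : 'rV[k]_n) : {set 'I_n} := [set i | y 0 i != 0].

Lemma notin_supp (y : 'rV[k]_n) i : (i \notin supp y) = (y 0 i == 0).
Proof. by rewrite inE negbK. Qed.

Lemma supp_eq0 (y : 'rV[k]_n) : (supp y == set0) = (y == 0).
Proof.
apply/eqP/eqP => [e|->]; last by apply/setP=> i; rewrite !inE mxE eqxx.
by apply/rowP => i; rewrite mxE; apply/eqP; rewrite -notin_supp e inE.
Qed.

Lemma supp0P (y : 'rV[k]_n) (A : {set 'I_n}) i :
  supp y \subset A -> i \notin A -> y 0 i = 0.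
Proof.
by move=> /subsetP h iA; apply/eqP; rewrite -notin_supp; apply: contra iA => /h.
Qed.

Variables (W : {vspace 'rV[k]_n}).

(** Linear duality: an obstruction to surjectivity of [W] onto the coordinates in [A] is a nonzero
    vector of [perp W] supported in [A]. *)
Lemma coordproj_onto (A : {set 'I_n}) (w : 'rV[k]_n) :
  (forall y, y \in perp W -> supp y \subset A -> y = 0) ->
  exists2 x, x \in W & forall i, i \in A -> x 0 i = w 0 i.
Proof.
move=> h; have hb := vbasisP W; set B := tuple_mx (vbasis W) in hb *.
pose D : 'M[k]_n := diag_mx (\row_i (i \in A)%:R).
have : (w *m D <= B *m D)%MS.
  (* Row space membership is tested on a cokernel [N] of [B D]. Each column of [D N] is orthogonal
     to [W] and supported in [A], hence zero. *)
  rewrite submxE; have := mulmx_coker (B *m D); move: (cokermx _) => N NE.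
  apply/eqP/rowP => j.
  have z0 : (D *m col j N)^T = 0.
    apply: h.
      by rewrite (mem_perp _ hb) -trmx_mul -/B colE !mulmxA NE mul0mx trmx0.
    apply/subsetP => i; rewrite !inE mul_diag_mx !mxE.
    by case: (i \in A); rewrite // mul0r eqxx.
  have : w *m (D *m col j N) = 0 by rewrite -[D *m _]trmxK z0 trmx0 mulmx0.
  by rewrite colE !mulmxA -colE => /rowP/(_ 0); rewrite !mxE.
case/submxP => E e; exists (E *m B).
  by rewrite (mem_tuple_mx _ hb) submxMl.
move=> i iA; move/rowP: e => /(_ i).
by rewrite mulmxA !mul_mx_diag !mxE iA !mulr1.
Qed.

Lemma coordproj_bij (A : {set 'I_n}) :
  bijective (@coordproj k n W A) <->
  (forall x, x \in W -> (forall i, i \in A -> x 0 i = 0) -> x = 0) /\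
  (forall w : 'rV[k]_n,
    exists2 x, x \in W & forall i, i \in A -> x 0 i = w 0 i).
Proof.
split=> [[h hK Kh]|[inj onto]].
  split=> [x xW x0|w].
    have e : @coordproj _ _ W A (vsproj W x) = coordproj A (vsproj W 0).
      by apply/ffunP=> -[i iA]; rewrite !ffunE /= !vsprojK ?mem0v // mxE x0.
    have := congr1 vsval (can_inj hK e).
    by rewrite !vsprojK ?mem0v.
  pose c : {ffun {i : 'I_n | i \in A} -> k} := [ffun i => w 0 (val i)].
  exists (vsval (h c)); first exact: subvsP.
  by move=> i iA; have /ffunP/(_ (Sub i iA)) := Kh c; rewrite !ffunE.
have ci : injective (@coordproj k n W A).
  move=> x y /ffunP e; apply/eqP; rewrite -subr_eq0; apply/eqP; apply: val_inj.
  rewrite linear0; apply: inj; first exact: subvsP.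
  move=> i iA; have := e (Sub i iA); rewrite !ffunE /= !mxE => ->.
  by rewrite subrr.
have cs (c : {ffun {i : 'I_n | i \in A} -> k}) :
    exists x, @coordproj _ _ W A x = c.
  (* The value 0 outside [A] merely extends [c] to a full vector. *)
  have [x xW e] := onto (\row_i if insub i is Some j then c j else 0).
  exists (vsproj W x); apply/ffunP => -[i iA].
  by rewrite !ffunE /= vsprojK // e // mxE insubT.
exists (fun c => projT1 (cid (cs c))) => [x|c]; last by case: (cid _).
by apply: ci; case: (cid _).
Qed.

Variable M : matroid 'I_n.
Hypothesis hW : realizes W M.

(** If [A] lies in a basis [D], some vector of [W] restricts on [D] to a given unit vector, and
    pairing with it reads off a coordinate of [y]. Conversely, a maximal set with the stated
    property that contains [A] is a basis. *)
Lemma mindepP (A : {set 'I_n}) :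
  mindep M A <-> forall y, y \in perp W -> supp y \subset A -> y = 0.
Proof.
split=> [/existsP[D /andP[DM AD]] y /perpP yW yA|h].
  have /coordproj_bij[_ onto] := (hW.2 D).1 DM.
  apply/rowP => i; rewrite mxE.
  have [iA|/(supp0P yA)//] := boolP (i \in A).
  have [x xW e] := onto (delta_mx 0 i); rewrite -[RHS](yW _ xW) (bigD1 i) //=.
  rewrite e ?(subsetP AD) // mxE !eqxx mul1r big1 ?addr0 // => j ji.
  have [jA|/(supp0P yA) ->] := boolP (j \in A); last by rewrite mulr0.
  by rewrite e ?(subsetP AD) // mxE eqxx (negPf ji) mul0r.
pose P (A : {set 'I_n}) :=
  `[< forall y, y \in perp W -> supp y \subset A -> y = 0 >].
have [D /maxsetP[/asboolP DP Dmax] AD] :=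
  @maxset_exists _ P A (introT (asboolP _) h).
apply/existsP; exists D; rewrite AD andbT; apply/(hW.2 D)/coordproj_bij.
split=> [x xW x0|w]; last exact: coordproj_onto.
apply/rowP => l; rewrite mxE; have [/x0//|lD] := boolP (l \in D).
apply/eqP/negP => /negP xl.
(* If [x] in [W] vanishes on [D] but not at [l], a vector [y] of [perp W] supported in [l |: D]
   pairs with [x] to [x_l y_l]. Hence [y_l = 0], and [l |: D] inherits the property, against
   maximality. *)
have/negP[] : ~~ P (l |: D).
  apply/negP => Pl; have := Dmax _ Pl (subsetUr _ _).
  by move/setP/(_ l); rewrite !inE eqxx (negPf lD).
apply/asboolP => y yW yl; apply: DP => //; apply/subsetP => i iy.
have := subsetP yl _ iy; rewrite !inE => /orP[/eqP il|//].
move/perpP: yW => /(_ _ xW); rewrite (bigD1 l) //= big1 => [|j jl]; last first.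
  have [/x0 ->|jD] := boolP (j \in D); first by rewrite mul0r.
  by rewrite (supp0P yl) ?mulr0 // !inE negb_or jl.
rewrite addr0 => /eqP; rewrite mulf_eq0 (negPf xl) /= -notin_supp -il.
by rewrite iy.
Qed.

Lemma mcircuitP (D : {set 'I_n}) : mcircuit M D ->
  exists2 y, y \in perp W & supp y = D.
Proof.
case/minsetP=> dep Dmin.
have [y [yW y0 yD]] : exists y, [/\ y \in perp W, y != 0 & supp y \subset D].
  apply: contra_notP (negP dep) => h; apply/mindepP => y yW yD.
  by apply/eqP/negP => /negP y0; apply: h; exists y.
exists y => //; apply: Dmin => //; apply/negP => /mindepP/(_ y yW (subxx _)).
exact/eqP.
Qed.

(** A nonzero [y] would have a dependent support inside [D], hence equal to [D] by minimality. This
    gives uniqueness of circuit vectors up to a scalar. *)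
Lemma mcircuit_eq0 (D : {set 'I_n}) y i : mcircuit M D -> y \in perp W ->
  supp y \subset D -> i \in D -> y 0 i = 0 -> y = 0.
Proof.
case/minsetP=> _ Dmin yW yD iD yi; apply/eqP/negP => /negP y0.
have : supp y = D.
  by apply: Dmin => //; apply/negP => /mindepP/(_ y yW (subxx _)); apply/eqP.
by move/setP/(_ i); rewrite iD inE yi eqxx.
Qed.

(** The multiple of [z] is chosen to cancel coordinate [i]. No new coordinate appears, since the
    support of [z] lies in that of [y]. *)
Lemma mcircuit_elim (y z : 'rV[k]_n) i : y \in perp W -> z \in perp W ->
  supp z \subset supp y -> i \in supp z ->
  exists2 v, v \in perp W & [/\ supp v \proper supp y &
    exists a, v = y - a *: z].
Proof.
move=> yW zW zy iz; exists (y - (y 0 i / z 0 i) *: z).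
  by rewrite memvB ?memvZ.
split; last by eexists.
apply/properP; split.
  apply/subsetP => j; rewrite -[j \in supp y]negbK notin_supp.
  apply: contraL => /eqP yj; have : j \notin supp z.
    by apply: contra (subsetP zy j) _; rewrite notin_supp yj.
  by rewrite !notin_supp !mxE => /eqP ->; rewrite yj mulr0 subr0.
exists i; first exact: (subsetP zy).
by move: iz; rewrite notin_supp !mxE inE => zi; rewrite divfK ?subrr.
Qed.

(** Induction on the size of the support: if a circuit inside it misses [x], subtracting a multiple
    of its vector shrinks the support and leaves coordinate [x] unchanged. *)
Lemma mcircuit_through (y : 'rV[k]_n) x : y \in perp W -> x \in supp y ->
  exists2 D, mcircuit M D & (x \in D) && (D \subset supp y).
Proof.
have [m] := ubnP #|supp y|; elim: m y => // m IH y ym yW xy.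
have dep : ~~ mindep M (supp y).
  apply/negP => /mindepP/(_ y yW (subxx _)) y0.
  by move: xy; rewrite inE y0 mxE eqxx.
have [D Dc Dy] := @minset_exists _ (fun A => ~~ mindep M A) _ dep.
have [xD|xD] := boolP (x \in D); first by exists D => //; rewrite xD.
have [z zW zD] := mcircuitP Dc.
(* A circuit is nonempty, because the empty set is independent. *)
have [i iz] : exists i, i \in supp z.
  apply/set0Pn; rewrite supp_eq0; apply: contra dep => /eqP z0.
  have /eqP s0 : supp z == set0 by rewrite supp_eq0 z0.
  have := minsetp Dc; rewrite -zD s0 => /negP[]; apply/mindepP => w _.
  by rewrite subset0 supp_eq0 => /eqP.
have zy : supp z \subset supp y by rewrite zD.
have [v vW [vy [a va]]] := mcircuit_elim yW zW zy iz.
have xv : x \in supp v.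
  have : x \notin supp z by rewrite zD.
  rewrite notin_supp inE va !mxE => /eqP ->; rewrite mulr0 subr0.
  by rewrite inE in xy.
have vm : (#|supp v| < m)%N by rewrite (leq_trans (proper_card vy)).
have [E Ec /andP[xE Ev]] := IH v vm vW xv.
by exists E => //; rewrite xE (subset_trans Ev) // proper_sub.
Qed.

(** The combination [v] of the two circuit vectors vanishes at [e] and equals [y] at [x], so a
    circuit through [x] inside its support is as required. *)
Lemma mcircuit_strong_elim (D1 D2 : {set 'I_n}) e x :
  mcircuit M D1 -> mcircuit M D2 -> e \in D1 -> e \in D2 ->
  x \in D1 -> x \notin D2 ->
  exists2 D, mcircuit M D & (x \in D) && (D \subset (D1 :|: D2) :\ e).
Proof.
move=> /mcircuitP[y yW yD1] /mcircuitP[z zW zD2] eD1 eD2 xD1 xD2.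
pose v := y - (y 0 e / z 0 e) *: z.
have ze : z 0 e != 0 by have := eD2; rewrite -zD2 inE.
have zx : z 0 x = 0 by apply/eqP; rewrite -notin_supp zD2.
have [||D Dc /andP[xD Dv]] := @mcircuit_through v x.
- by rewrite memvB ?memvZ.
- by rewrite inE !mxE zx mulr0 subr0; have := xD1; rewrite -yD1 inE.
exists D; rewrite // xD (subset_trans Dv) //; apply/subsetP => i.
rewrite 3!inE -yD1 -zD2 2!inE !mxE; apply: contraR.
rewrite negb_and negb_or !negbK notin_supp.
move=> /orP[/eqP ->|/andP[/eqP -> /eqP ->]].
  by rewrite divfK ?subrr.
by rewrite mulr0 subrr.
Qed.

(* Among the pairs of meeting circuits through [x] and [z] take one with the
   smallest union. *)
Lemma mconnected_trans (x y z : 'I_n) :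
  mconnected M x y -> mconnected M y z -> mconnected M x z.
Proof.
case/predU1P=> [->//|/existsP[C1 /and3P[C1c xC1 yC1]]].
case/predU1P=> [<-|/existsP[C2 /and3P[C2c yC2 zC2]]].
  by apply/orP; right; apply/existsP; exists C1; rewrite C1c xC1.
have [m] := ubnP #|C1 :|: C2|.
elim: m C1 C2 y C1c xC1 yC1 C2c yC2 zC2 => // m IH.
move=> C1 C2 e C1c xC1 eC1 C2c eC2 zC2 mC.
have connI D : mcircuit M D -> x \in D -> z \in D -> mconnected M x z.
  by move=> Dc xD zD; apply/orP; right; apply/existsP; exists D; rewrite Dc xD.
have [/connI|xC2] := boolP (x \in C2); first exact.
have [/(connI _ C1c xC1)//|zC1] := boolP (z \in C1).
(* Now neither circuit contains both [x] and [z]. Eliminating [e] from either side gives [D1]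
   through [x] and [D2] through [z]. *)
have [D1 D1c /andP[xD1 D1s]] :=
  mcircuit_strong_elim C1c C2c eC1 eC2 xC1 xC2.
have [D2 D2c /andP[zD2 D2s]] :=
  mcircuit_strong_elim C2c C1c eC2 eC1 zC2 zC1.
have ltU (D : {set 'I_n}) (F : {set 'I_n}) a : D \subset C1 :|: C2 ->
    F \subset C1 :|: C2 -> a \in C1 :|: C2 -> a \notin D -> a \notin F ->
    (#|D :|: F| < m)%N.
  move=> DC FC aC aD aF; rewrite -ltnS; apply: leq_trans mC; rewrite ltnS.
  apply: proper_card; apply/properP; split; first by rewrite subUset DC.
  by exists a; rewrite // inE negb_or aD.
have min_eq (D : {set 'I_n}) C :
    mcircuit M D -> mcircuit M C -> D \subset C -> C = D.
  by move=> Dc /minsetP[_ Cmin] DC; rewrite (Cmin D) // (minsetp Dc).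
have D1C : D1 \subset C1 :|: C2 by apply: subset_trans D1s (subsetDl _ _).
have D2C : D2 \subset C1 :|: C2.
  by rewrite setUC; apply: subset_trans D2s (subsetDl _ _).
have eD1 : e \notin D1 by apply/negP => /(subsetP D1s); rewrite !inE eqxx.
have eD2 : e \notin D2 by apply/negP => /(subsetP D2s); rewrite !inE eqxx.
(* Circuits are incomparable and [e] lies in [C1] but not in [D1], so [D1] leaves [C1]; likewise
   [D2] leaves [C2]. *)
have [a aD1 aC1] : exists2 a, a \in D1 & a \notin C1.
  apply/subsetPn; apply: contra eD1 => /(min_eq _ _ D1c C1c) <- //.
have [c cD2 cC2] : exists2 c, c \in D2 & c \notin C2.
  apply/subsetPn; apply: contra eD2 => /(min_eq _ _ D2c C2c) <- //.
have aC2 : a \in C2 by have := subsetP D1C a aD1; rewrite inE (negPf aC1).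
(* If [a] is in [D2], the pair [D1], [D2] meets at [a] and its union omits [e]. Otherwise [C1], [D2]
   meets at [c] and its union omits [a]. *)
have [aD2|aD2] := boolP (a \in D2).
  apply: (IH D1 D2 a) => //; apply: (ltU _ _ e) => //.
  by rewrite inE eC1.
apply: (IH C1 D2 c) => //; last first.
  by apply: (ltU _ _ a) => //; rewrite ?subsetUl // inE aC2 orbT.
by have := subsetP D2C c cD2; rewrite inE (negPf cC2) orbF.
Qed.

Lemma mconnected_equiv : equivalence_rel (mconnected M).
Proof.
apply/equivalence_relP; split=> [x|x y xy]; first by rewrite /mconnected eqxx.
have sym u v : mconnected M u v -> mconnected M v u.
  rewrite /mconnected eq_sym => /orP[->//|/existsP[C /and3P[Cc uC vC]]].
  by apply/orP; right; apply/existsP; exists C; rewrite Cc vC.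
move=> z; apply/idP/idP; first by apply: mconnected_trans; apply: sym.
exact: mconnected_trans.
Qed.

Definition scale_coord (c : 'I_n -> k) (y : 'rV[k]_n) : 'rV[k]_n :=
  \row_i (c i * y 0 i).

(* The first condition says that diag(c) maps [perp W] to itself. A circuit
   vector is unique up to a scalar, hence then an eigenvector of diag(c), and
   the circuit vectors span [perp W]. *)
Lemma scale_coord_perp (c : 'I_n -> k) :
  (forall x y, x \in W -> y \in perp W -> \sum_i c i * x 0 i * y 0 i = 0) <->
  (forall i j, mconnected M i j -> c i = c j).
Proof.
split=> [h i j|h x y xW].
  case/predU1P=> [->//|/existsP[D /and3P[Dc iD jD]]].
  have [y yW yD] := mcircuitP Dc.
  (* This difference lies in [perp W], is supported in the circuit [D] and vanishes at [i]. *)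
  have : scale_coord c y - c i *: y = 0.
    apply: (@mcircuit_eq0 D _ i) => //; last by rewrite !mxE subrr.
      rewrite memvB ?memvZ //; apply/perpP => x xW; rewrite -[RHS](h x y) //.
      by apply: eq_bigr => l _; rewrite mxE mulrCA mulrA.
    apply/subsetP => l; rewrite -yD 2!inE !mxE; apply: contraNneq => ->.
    by rewrite !mulr0 subrr.
  move/rowP/(_ j); rewrite !mxE -mulrBl => /eqP.
  rewrite mulf_eq0 subr_eq0 eq_sym => /orP[/eqP//|].
  by have := jD; rewrite -yD inE => /negPf ->.
have [m] := ubnP #|supp y|; elim: m y => // m IH y ym yW.
have [y0|[x0 x0y]] : y = 0 \/ exists x, x \in supp y.
  case: (set_0Vmem (supp y)) => [/eqP|[x0 x0y]]; last by right; exists x0.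
  by rewrite supp_eq0 => /eqP; left.
  by rewrite big1 // => i _; rewrite y0 mxE mulr0.
have [D Dc /andP[x0D Dy]] := mcircuit_through yW x0y.
have [z zW zD] := mcircuitP Dc.
have zy : supp z \subset supp y by rewrite zD.
have x0z : x0 \in supp z by rewrite zD.
have [v vW [vy [a va]]] := mcircuit_elim yW zW zy x0z.
have vm : (#|supp v| < m)%N by rewrite (leq_trans (proper_card vy)).
have -> : y = v + a *: z by rewrite va subrK.
under eq_bigr do rewrite !mxE mulrDr.
rewrite big_split /= IH // add0r.
(* On the circuit [D], the support of [z], the function [c] has the constant value [c x0], so what
   remains is a multiple of the pairing of [x] and [z]. *)
transitivity (\sum_i (a * c x0) * (x 0 i * z 0 i)).
  apply: eq_bigr => i _; have [iD|] := boolP (i \in D).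
    rewrite (h i x0); last first.
      by apply/orP; right; apply/existsP; exists D; rewrite Dc iD.
    by rewrite mulrCA !mulrA.
  by rewrite -zD notin_supp => /eqP ->; rewrite !mulr0.
by rewrite -mulr_sumr (perpP W z).1 // mulr0.
Qed.

(** Otherwise the unit vector at [i] is orthogonal to [perp W], hence in [W]. It vanishes on a basis
    omitting [i], against injectivity of the projection. *)
Lemma noncoloop_perp i : ~~ mcoloop M i -> exists2 y, y \in perp W & y 0 i != 0.
Proof.
rewrite negb_forall => /existsP[D]; rewrite negb_imply => /andP[DM iD].
apply: contrapT => h; have /coordproj_bij[inj _] := (hW.2 D).1 DM.
have dW : delta_mx 0 i \in W.
  apply: perp_perp => y yW; rewrite big1 // => l _; rewrite !mxE eqxx.
  case: eqP => [->|_]; rewrite ?mul0r // mul1r.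
  by apply/eqP/negP => /negP y0; apply: h; exists y.
have /rowP/(_ i) : delta_mx 0 i = 0 :> 'rV[k]_n.
  apply: inj => // l lD; rewrite !mxE eqxx.
  by case: eqP lD => // ->; rewrite (negPf iD).
by rewrite !mxE !eqxx => /eqP; rewrite oner_eq0.
Qed.

(** Otherwise the unit vector at [i] lies in [perp W], which makes [[set i]] dependent. *)
Lemma nonloop_mem i : ~~ mloop M i -> exists2 x, x \in W & x 0 i != 0.
Proof.
rewrite negbK => /mindepP ind; apply: contrapT => h.
have /rowP/(_ i) : delta_mx 0 i = 0 :> 'rV[k]_n.
  apply: ind; last first.
    apply/subsetP => l; rewrite !inE mxE eqxx /=.
    by case: (l == i); rewrite ?eqxx.
  apply/perpP => x xW; rewrite big1 // => l _; rewrite !mxE eqxx.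
  case: eqP => [->|_]; rewrite ?mulr0 // mulr1.
  by apply/eqP/negP => /negP x0; apply: h; exists x.
by rewrite !mxE !eqxx => /eqP; rewrite oner_eq0.
Qed.

End Realization.

Lemma coordform_neq0 (k : fieldType) (n r : nat) (W : {vspace 'rV[k]_n})
    (b : r.-tuple 'rV[k]_n) i :
  basis_of W b -> (exists2 x, x \in W & x 0 i != 0) -> coordform b i != 0.
Proof.
move=> hb [x]; rewrite (mem_tuple_mx _ hb) => /submxP[D ->] xi.
apply: contra xi => /eqP f0; rewrite mxE big1 // => j _.
suff -> : tuple_mx b j i = 0 by rewrite mulr0.
have := congr1 (mcoeff U_(j)) f0; rewrite mcoeff0 raddf_sum /= (bigD1 j) //=.
rewrite mcoeffZ mcoeffXU eqxx mulr1 big1 ?addr0 => [<-|l lj].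
  by rewrite mxE.
by rewrite mcoeffZ mcoeffXU (negPf lj) mulr0.
Qed.

(** * Logarithmic derivations *)

Lemma mpoly_ring_ind (k : fieldType) (r : nat) (P : {mpoly k[r]} -> Prop) :
  (forall c, P c%:MP) -> (forall j, P 'X_j) ->
  (forall p q, P p -> P q -> P (p + q)) ->
  (forall p q, P p -> P q -> P (p * q)) ->
  forall p, P p.
Proof.
move=> PC PX PD PM p; rewrite [p]mpolyE.
elim/big_ind: _ => [||m _]; [by rewrite -mpolyC0|exact: PD|].
rewrite -mul_mpolyC; apply: (PM) => //; rewrite mpolyXE_id.
elim/big_ind: _ => [||i _]; [by rewrite -mpolyC1|exact: PM|].
elim: (m i) => [|d IH]; first by rewrite expr0 -mpolyC1.
by rewrite exprS; apply: PM.
Qed.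

(** * Homogeneous polynomials with integer degrees *)

Section Homogeneous.
Variables (k : fieldType) (r : nat).
Local Notation R := {mpoly k[r]}.
Implicit Types (p q : R) (d e : int).

Lemma homogzP d p :
  reflect (forall m, m \in msupp p -> (mdeg m)%:Z = d) (homogz d p).
Proof. by apply: (iffP allP) => h m /h /eqP. Qed.

Lemma homogz_nat (d : nat) p : homogz d p = (p \is d.-homog).
Proof. by rewrite dhomogE; apply: eq_all => m /=; rewrite eqz_nat. Qed.

Lemma homogz0 d : homogz d (0 : R).
Proof. by rewrite /homogz msupp0. Qed.

Lemma homogzD d p q : homogz d p -> homogz d q -> homogz d (p + q).
Proof.
move=> /homogzP P /homogzP Q; apply/homogzP => m /msuppD_le.
by rewrite mem_cat => /orP[/P|/Q].
Qed.

Lemma homogzZ d (c : k) p : homogz d p -> homogz d (c *: p).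
Proof. by move=> /homogzP P; apply/homogzP => m /msuppZ_le /P. Qed.

Lemma homogzM d e p q : homogz d p -> homogz e q -> homogz (d + e) (p * q).
Proof.
move=> /homogzP P /homogzP Q; apply/homogzP => m /msuppM_le.
by case/allpairsP => -[m1 m2] /= [/P<- /Q<- ->]; rewrite mdegD.
Qed.

Lemma homogz_sum d (I : Type) (t : seq I) (F : I -> R) :
  (forall i, homogz d (F i)) -> homogz d (\sum_(i <- t) F i).
Proof.
by move=> h; elim/big_ind: _ => [|p q|]; [exact: homogz0|exact: homogzD|].
Qed.

Lemma homogz_mderiv d j p : homogz d p -> homogz (d - 1) p^`M(j).
Proof.
move=> /homogzP P; apply/homogzP => m; rewrite mcoeff_msupp mcoeff_deriv => h.
have /P <- : (m + U_(j))%MM \in msupp p.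
  by rewrite mcoeff_msupp; apply: contraNneq h => ->; rewrite mul0rn.
by rewrite mdegD mdeg1 PoszD addrK.
Qed.

(** Multiplication by [p] shifts the degree of every monomial of [q] by exactly [d]. *)
Lemma pihomogM (d e : nat) p q : p \is d.-homog ->
  pihomog mdeg (d + e) (p * q) = p * pihomog mdeg e q.
Proof.
move=> hp; rewrite {1}[q]mpolyE mulr_sumr raddf_sum /=.
rewrite [in RHS]pihomogE mulr_sumr [in RHS]big_mkcond; apply: eq_bigr => m _.
have h : p * (q@_m *: 'X_[m]) \is (d + mdeg m).-homog.
  by rewrite dhomogM // dhomogZ // dhomogX.
case: eqP => [<-|/eqP em]; first by rewrite pihomog_dE.
by rewrite (pihomog_ne0 _ h) // eqn_add2l.
Qed.

Lemma mcoeff_pihomog m p : (pihomog mdeg (mdeg m) p)@_m = p@_m.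
Proof.
rewrite {2}[p]mpolyE pihomogE !raddf_sum /= big_mkcond; apply: eq_bigr => m' _.
rewrite mcoeffZ mcoeffX; have [->|] := eqVneq m' m.
  by rewrite eqxx.
by rewrite mulr0; case: ifP.
Qed.

(** A nonzero homogeneous component of [q] stays nonzero after multiplication by [p], so it shows up
    in [p * q] and has degree [e]. *)
Lemma homogz_mulKl d e p q : p != 0 -> homogz d p -> homogz (d + e) (p * q) ->
  homogz e q.
Proof.
move=> p0 hp /homogzP hpq; apply/homogzP => m mq.
(* A negative [d] is impossible: [p] is nonzero and so has a monomial. *)
case: d hp hpq => [d|d] hp hpq; last first.
  have [|h0] := eqVneq (msupp p) [::].
    by move/eqP; rewrite msupp_eq0 (negPf p0).
  case E : (msupp p) h0 => [//|m0 t] _.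
  by have /homogzP/(_ m0) := hp; rewrite E mem_head => /(_ isT).
rewrite homogz_nat in hp.
have : p * pihomog mdeg (mdeg m) q != 0.
  rewrite mulf_neq0 //; apply: contraTneq mq => h0.
  by rewrite mcoeff_msupp -mcoeff_pihomog h0 mcoeff0 eqxx.
rewrite -(pihomogM _ _ hp) pihomogE; apply: contraNeq => me.
rewrite big_seq_cond big1 // => m' /andP[/hpq E /eqP F]; case/eqP: me.
by apply: (addrI (Posz d)); rewrite -PoszD -F.
Qed.

End Homogeneous.

(** * Derivations of a polynomial ring *)

Section Derivation.
Variables (k : fieldType) (r : nat).
Local Notation R := {mpoly k[r]}.

Lemma derivation_additive (theta : R -> R) : derivation theta ->
  [/\ theta 0 = 0, forall p q, theta (p + q) = theta p + theta q,
      forall (c : k) p, theta (c *: p) = c *: theta p &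
      forall c, theta c%:MP = 0].
Proof.
case=> L D.
have t0 : theta 0 = 0.
  by have := L (-1) 0 0; rewrite scaler0 addr0 scaleN1r addNr.
have tD p q : theta (p + q) = theta p + theta q.
  by rewrite -[p]scale1r L !scale1r.
have tZ c p : theta (c *: p) = c *: theta p.
  by rewrite -[c *: p]addr0 L t0 addr0.
split=> // c; rewrite -alg_mpolyC tZ.
suff -> : theta 1 = 0 by rewrite scaler0.
have := D 1 1; rewrite !mulr1 mul1r => /eqP.
by rewrite -subr_eq0 opprD addrA subrr sub0r oppr_eq0 => /eqP.
Qed.

Lemma derivation_sum (theta : R -> R) (I : Type) (t : seq I) (c : I -> k)
    (F : I -> R) :
  derivation theta ->
  theta (\sum_(i <- t) c i *: F i) = \sum_(i <- t) c i *: theta (F i).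
Proof.
case/derivation_additive => t0 tD tZ _; rewrite (big_morph theta tD t0).
by apply: eq_bigr => i _; rewrite tZ.
Qed.

Definition vector_field (t : 'I_r -> R) (p : R) : R := \sum_j t j * p^`M(j).

Lemma vector_field_derivation t : derivation (vector_field t).
Proof.
split=> [c|] p q.
  rewrite /vector_field scaler_sumr -big_split /=; apply: eq_bigr => j _.
  by rewrite mderivD mderivZ mulrDr scalerAr.
rewrite /vector_field mulr_suml mulr_sumr -big_split /=; apply: eq_bigr => j _.
by rewrite mderivM mulrDr (mulrCA p) !mulrA.
Qed.

Lemma mderivXU (i j : 'I_r) : ('X_i : R)^`M(j) = (i == j)%:R.
Proof.
rewrite mderivX mnm1E; case: eqP => [->|_]; last by rewrite scale0r.
by rewrite scale1r -[X in (X - _)%MM]add0m addmK mpolyX0.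
Qed.

Lemma eq_derivation (t1 t2 : R -> R) : derivation t1 -> derivation t2 ->
  (forall j, t1 'X_j = t2 'X_j) -> t1 =1 t2.
Proof.
move=> d1 d2 h; have [_ D1 _ C1] := derivation_additive d1.
have [_ D2 _ C2] := derivation_additive d2.
apply: mpoly_ring_ind => [c|//|p q hp hq|p q hp hq]; first by rewrite C1 C2.
  by rewrite D1 D2 hp hq.
by rewrite d1.2 d2.2 hp hq.
Qed.

End Derivation.

(** * Logarithmic derivations as vectors of quotients *)

Section LogDerivation.
Variables (k : fieldType) (r s n : nat).
Variables (b : r.-tuple 'rV[k]_n) (b' : s.-tuple 'rV[k]_n).
Local Notation R := {mpoly k[r]}.
Local Notation f := (coordform b).

Lemma homogz_coordform i : homogz 1 (f i).
Proof.
apply: homogz_sum => j; apply: homogzZ; apply/homogzP => m.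
by rewrite msuppX inE => /eqP ->; rewrite mdeg1.
Qed.

Lemma mderiv_coordform i j : (f i)^`M(j) = (tnth b j 0 i)%:MP.
Proof.
rewrite /coordform raddf_sum (bigD1 j) //= mderivZ mderivXU eqxx big1.
  by rewrite addr0 alg_mpolyC.
by move=> l lj; rewrite mderivZ mderivXU (negPf lj) scaler0.
Qed.

Variables (X : 'M[k]_(n, r)) (T : 'M[k]_(s, n)).
Hypothesis frame : dual_frame (tuple_mx b) (tuple_mx b') X T.

Lemma frame_orth j l : \sum_i tnth b j 0 i * tnth b' l 0 i = 0.
Proof.
case: frame => /matrixP/(_ j l) h _ _ _.
move: h; rewrite !mxE => h; rewrite -[RHS]h.
by apply: eq_bigr => i _; rewrite !mxE.
Qed.

Lemma sum_coordform l : \sum_i tnth b' l 0 i *: f i = 0.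
Proof.
rewrite /coordform; under eq_bigr do rewrite scaler_sumr.
rewrite exchange_big big1 //= => j _.
under eq_bigr do rewrite scalerA mulrC.
by rewrite -scaler_suml frame_orth scale0r.
Qed.

(** The [f i] span the linear forms, as [X] is a right inverse of [B]; so a derivation is determined
    by its values on them. *)
Lemma varE j : 'X_j = \sum_i X i j *: f i.
Proof.
case: frame => _ /matrixP BX _ _.
transitivity (\sum_l (l == j)%:R *: ('X_l : R)).
  rewrite (bigD1 j) //= eqxx scale1r big1 ?addr0 // => l /negPf ->.
  by rewrite scale0r.
rewrite /coordform; under [RHS]eq_bigr do rewrite scaler_sumr.
rewrite exchange_big /=; apply: eq_bigr => l _.
under eq_bigr do rewrite scalerA; rewrite -scaler_suml; congr (_ *: _).
move: (BX l j); rewrite !mxE => <-; apply: eq_bigr => i _.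
by rewrite !mxE mulrC.
Qed.

(* [v] lists the quotients theta (f i) / f i of a logarithmic derivation theta:
   the vector [v i * f i] has to lie in [W] tensored with [R]. *)
Definition log_vec (v : 'rV[R]_n) : Prop :=
  forall l, \sum_i tnth b' l 0 i *: (v 0 i * f i) = 0.

(** The coefficients are forced by [varE]: the image of ['X_j] has to be the same combination of the
    prescribed values [v 0 i * f i]. *)
Definition log_field (v : 'rV[R]_n) : R -> R^o :=
  vector_field (fun j => \sum_i X i j *: (v 0 i * f i)).

(** Evaluation at the forms multiplies the row of the [v 0 i * f i] by [X B = 1 - B'^T T], and
    [log_vec] says that [B'^T] kills this row. *)
Lemma log_fieldE v i : log_vec v -> log_field v (f i) = v 0 i * f i.
Proof.
case: frame => _ _ _ E vP; rewrite /log_field /vector_field.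
transitivity (\sum_j \sum_i0 (X i0 j * tnth b j 0 i) *: (v 0 i0 * f i0)).
  apply: eq_bigr => j _; rewrite mderiv_coordform mulrC mul_mpolyC scaler_sumr.
  by apply: eq_bigr => l _; rewrite scalerA mulrC.
rewrite exchange_big /=.
transitivity (\sum_i0 (i0 == i)%:R *: (v 0 i0 * f i0)); last first.
  rewrite (bigD1 i) //= eqxx scale1r big1 ?addr0 // => l /negPf ->.
  by rewrite scale0r.
have {}E l : (l == i)%:R = \sum_j X l j * tnth b j 0 i +
    \sum_m T m i * tnth b' m 0 l.
  move/matrixP: E => /(_ l i); rewrite !mxE => ->; congr (_ + _).
    by apply: eq_bigr => j _; rewrite !mxE.
  by apply: eq_bigr => j _; rewrite !mxE mulrC.
under [RHS]eq_bigr do rewrite E scalerDl.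
rewrite big_split /= [X in _ + X](_ : _ = 0) ?addr0.
  by apply: eq_bigr => l _; rewrite scaler_suml.
under eq_bigr do rewrite scaler_suml.
rewrite exchange_big big1 //= => m _.
under eq_bigr do rewrite -scalerA.
by rewrite -scaler_sumr vP scaler0.
Qed.

Lemma log_field_in v : log_vec v -> log_field v \in log_derivation f.
Proof.
move=> vP; apply/asboolP; split; first exact: vector_field_derivation.
by move=> i; exists (v 0 i); rewrite log_fieldE // mulrC.
Qed.

(** Applying [theta] to the linear relations [sum_coordform] among the forms gives the conditions of
    [log_vec]. *)
Lemma log_vec_der (theta : Der f) : exists2 v, log_vec v &
  forall i, theta (f i) = v 0 i * f i.
Proof.
case: theta => theta /= /asboolP[der h].
pose v : 'rV[R]_n := \row_i projT1 (cid (h i)).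
have vE i : theta (f i) = v 0 i * f i.
  by rewrite mxE mulrC; case: (cid _).
exists v => // l; under eq_bigr do rewrite -vE.
rewrite -derivation_sum // sum_coordform.
by case: (derivation_additive der).
Qed.

Lemma eq_der (t1 t2 : Der f) : (forall i, t1 (f i) = t2 (f i)) -> t1 = t2.
Proof.
move=> h; apply: val_inj; apply: funext.
have der (t : Der f) : derivation t by case: t => t /= /asboolP[].
apply: (eq_derivation (der t1) (der t2)) => j.
rewrite varE.
rewrite (derivation_sum _ _ _ (der t1)) (derivation_sum _ _ _ (der t2)).
by apply: eq_bigr => i _; rewrite -[\val t1 _]/(t1 _) h.
Qed.

Hypothesis f_neq0 : forall i, f i != 0.

(** The value at [f i] is [v 0 i * f i], of degree [d + 1], and [f i] can be cancelled. Conversely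
    the coefficients have degree [d + 1], while partial derivatives lower degrees by 1. *)
Lemma log_field_deg d v (vP : log_vec v) :
  der_deg d (MkDer (log_field_in vP)) <-> forall i, homogz d (v 0 i).
Proof.
split=> [h i|h e p hp].
  apply: (homogz_mulKl (f_neq0 i) (homogz_coordform i)).
  by rewrite mulrC -log_fieldE //; apply: h; apply: homogz_coordform.
have -> : e + d = (d + 1) + (e - 1) by rewrite [RHS]addrACA subrr addr0 addrC.
apply: homogz_sum => j; apply: homogzM; last exact: homogz_mderiv.
by apply: homogz_sum => i; apply/homogzZ/homogzM => //; apply: homogz_coordform.
Qed.

Variables (U : lmodType R) (gU : int -> U -> Prop).
Variable chi : {linear U -> 'rV[R]_n}.
Hypothesis chi_inj : injective chi.
Hypothesis chi_range : forall v, (exists u, chi u = v) <-> log_vec v.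
Hypothesis chi_deg : forall d u,
  gU d u <-> forall i, homogz (d - 1) (chi u 0 i).

(** [U] is any graded module embedded by [chi] onto the vectors satisfying [log_vec]. Linearity and
    surjectivity are checked on the [f i]; injectivity cancels the nonzero [f i]. *)
Lemma log_der_iso : graded_iso gU (gshift (@der_deg k r n f) (-1)).
Proof.
have chiP u : log_vec (chi u) by apply/chi_range; exists u.
pose phi u : Der f := MkDer (log_field_in (chiP u)).
have phi_lin : linear phi.
  move=> a u v; apply: eq_der => i.
  have vE (t1 t2 : Der f) p : (a *: t1 + t2) p = a * t1 p + t2 p by [].
  by rewrite vE /= !log_fieldE // linearP !mxE mulrDl mulrA.
pose phiL : {linear U -> Der f} :=
  HB.pack phi (GRing.isLinear.Build _ _ _ _ phi phi_lin).
exists phiL; split; last first.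
  move=> d u; apply: iff_trans (chi_deg d u) _.
  by apply: iff_sym; apply: log_field_deg.
have phi_inj : injective phi.
  move=> u v e; apply: chi_inj; apply/rowP => i; apply: (mulIf (f_neq0 i)).
  by rewrite -!log_fieldE //; move/(congr1 (fun t : Der f => t (f i))): e.
have phi_surj theta : exists u, phi u = theta.
  have [v vP vE] := log_vec_der theta; have [u uv] := (chi_range v).2 vP.
  by exists u; apply: eq_der => i; rewrite /= log_fieldE // uv vE.
exists (fun theta => projT1 (cid (phi_surj theta))) => [u|theta];
  last by case: (cid _).
by apply: phi_inj; case: (cid _).
Qed.

End LogDerivation.

(** * Relations among the pairs *)

Section Embedding.
Variables (k : fieldType) (r N : nat) (lam : 'I_r -> 'I_N).
Hypothesis lam_inj : injective lam.
Local Notation R := {mpoly k[r]}.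
Local Notation S := {mpoly k[N]}.

Definition emb : R -> S := comp_mpoly [tuple 'X_(lam j) | j < r].
HB.instance Definition _ := GRing.RMorphism.on emb.
(** For injective [lam] the sum has at most one term; it is empty, so the variable goes to 0,
    outside the image of [lam]. *)
Definition retr : S -> R :=
  comp_mpoly [tuple \sum_(j < r | lam j == i) 'X_j | i < N].
HB.instance Definition _ := GRing.RMorphism.on retr.

Lemma embC c : emb c%:MP = c%:MP.
Proof. exact: comp_mpolyC. Qed.

Lemma embZ c p : emb (c *: p) = c *: emb p.
Proof. exact: comp_mpolyZ. Qed.

Lemma embXU j : emb 'X_j = 'X_(lam j).
Proof. by rewrite /emb comp_mpolyXU -tnth_nth tnth_mktuple. Qed.

Lemma embK : cancel emb retr.
Proof.
apply: mpoly_ring_ind => [c|j|p q hp hq|p q hp hq]; last 2 first.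
- by rewrite !rmorphD /= hp hq.
- by rewrite !rmorphM /= hp hq.
- by rewrite embC /retr comp_mpolyC.
rewrite embXU /retr comp_mpolyXU -tnth_nth tnth_mktuple.
by rewrite (big_pred1 j) // => i; rewrite /= (inj_eq lam_inj).
Qed.

Definition emnm (m : 'X_{1..r}) : 'X_{1..N} :=
  (\sum_(j < r) U_(lam j) *+ m j)%MM.

Lemma embX m : emb 'X_[m] = 'X_[emnm m].
Proof.
rewrite /emb comp_mpolyX; under eq_bigr do rewrite tnth_mktuple.
exact: mprodXnE.
Qed.

Lemma emnm_lam m j : emnm m (lam j) = m j.
Proof.
rewrite /emnm mnm_sumE (bigD1 j) //= mulmnE mnm1E eqxx mul1n.
rewrite big1 ?addn0 // => l lj.
by rewrite mulmnE mnm1E (inj_eq lam_inj) (negPf lj).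
Qed.

Lemma emnm_notin m i : (forall j, lam j != i) -> emnm m i = 0%N.
Proof.
move=> h; rewrite /emnm mnm_sumE big1 // => j _.
by rewrite mulmnE mnm1E (negPf (h j)).
Qed.

Lemma emnm_inj : injective emnm.
Proof. by move=> m m' e; apply/mnmP => j; rewrite -!emnm_lam e. Qed.

Lemma embE p : emb p = \sum_(m <- msupp p) p@_m *: 'X_[emnm m].
Proof.
rewrite {1}[p]mpolyE rmorph_sum; apply: eq_bigr => m _.
by rewrite /= embZ embX.
Qed.

Lemma mcoeff_emb p m : (emb p)@_(emnm m) = p@_m.
Proof.
rewrite embE [in RHS](mpolyE p) !raddf_sum; apply: eq_bigr => m' _ /=.
by rewrite !mcoeffZ !mcoeffX (inj_eq emnm_inj).
Qed.

Lemma msupp_emb p m :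
  m \in msupp (emb p) -> exists2 m', m' \in msupp p & m = emnm m'.
Proof.
rewrite embE => /msupp_sum_le/flattenP[t /mapP[m']].
rewrite mem_filter => /andP[_ mp] ->.
by move=> /msuppZ_le; rewrite msuppX inE => /eqP ->; exists m'.
Qed.

Lemma mderiv_emb i p : (forall j, lam j != i) -> (emb p)^`M(i) = 0.
Proof.
move=> h; elim/mpoly_ring_ind: p => [c|j|p q hp hq|p q hp hq].
- by rewrite embC mderivC.
- by rewrite embXU mderivXU (negPf (h j)).
- by rewrite rmorphD mderivD hp hq addr0.
- by rewrite rmorphM mderivM hp hq mul0r mulr0 addr0.
Qed.

Lemma in_emb h :
  (forall m i, m \in msupp h -> (forall j, lam j != i) -> m i = 0%N) ->
  emb (retr h) = h.
Proof.
move=> H.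
pose p := \sum_(m <- msupp h) h@_m *: 'X_[[multinom m (lam j) | j < r]].
suff -> : h = emb p by rewrite embK.
rewrite {1}[h]mpolyE rmorph_sum; apply: eq_big_seq => m mh.
rewrite /= embZ embX.
congr (_ *: 'X_[_]); apply/mnmP => i.
have [/existsP[j /eqP <-]|/existsPn hi] := boolP [exists j, lam j == i].
  by rewrite emnm_lam mnmE.
by rewrite emnm_notin // H.
Qed.

End Embedding.

(** * Relations of degree 1 in one block of variables *)

Section PairRelations.
Variables (k : fieldType) (r s n N : nat).
Variables (lam : 'I_r -> 'I_N) (rho : 'I_s -> 'I_N).
Hypothesis lam_inj : injective lam.
Hypothesis rho_inj : injective rho.
Hypothesis lam_rho : forall j l, lam j != rho l.
Hypothesis lam_rho_cover : forall i,
  (exists j, lam j = i) \/ (exists l, rho l = i).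
Local Notation R := {mpoly k[r]}.
Local Notation S := {mpoly k[N]}.
Variables (b : r.-tuple 'rV[k]_n) (b' : s.-tuple 'rV[k]_n).
Local Notation f := (coordform b).
Local Notation g := (coordform b').
Local Notation embo := (emb rho).
Local Notation emb := (emb lam).
Local Notation retr := (retr lam).

(* [lam], [rho] are the two inclusions of variables into those of [S], in either
   order: the same argument serves K_(.,1) and K_(1,.). *)
Definition pair_sum (u : 'rV[S]_n) : S :=
  \sum_i u 0 i * (emb (f i) * embo (g i)).

(** The degree in the [rho] variables is 0 because the generators already account for the 1 in
    [K_(.,1)]. *)
Definition left_homog (p : int) (h : S) : Prop := forall m, m \in msupp h ->
  (\sum_j m (lam j))%N%:Z = p /\ (\sum_l m (rho l))%N%:Z = 0.

Definition pair_rel (p : int) (u : 'rV[S]_n) : Prop :=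
  pair_sum u = 0 /\ forall i, left_homog (p - 1) (u 0 i).

Lemma pair_sum_emb (v : 'rV[R]_n) : pair_sum (map_mx emb v) =
  \sum_l 'X_(rho l) * emb (\sum_i tnth b' l 0 i *: (v 0 i * f i)).
Proof.
under [RHS]eq_bigr do rewrite rmorph_sum mulr_sumr.
rewrite exchange_big; apply: eq_bigr => i _ /=.
rewrite mxE [X in _ * (_ * X)]rmorph_sum.
rewrite mulrA mulr_sumr -rmorphM; apply: eq_bigr => l _ /=.
by rewrite !embZ embXU -scalerAr mulrC scalerAr.
Qed.

Lemma pair_sum_emb_eq0 (v : 'rV[R]_n) :
  pair_sum (map_mx emb v) = 0 <-> log_vec b b' v.
Proof.
rewrite pair_sum_emb; split=> [h l|h]; last first.
  by rewrite big1 // => l _; rewrite h rmorph0 mulr0.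
apply: (can_inj (embK lam_inj)); rewrite [RHS]rmorph0.
(* Differentiating by the variable [rho l] isolates its coefficient, since the image of [emb] is
   free of the [rho] variables. *)
have := congr1 (mderiv (rho l)) h; rewrite mderiv0 raddf_sum (bigD1 l) //=.
rewrite mderivM mderivXU eqxx mul1r mderiv_emb => [|j]; last exact: lam_rho.
rewrite mulr0 addr0 [\sum_(i < s | _) _]big1 ?addr0 // => l' ll'.
rewrite mderivM mderivXU (inj_eq rho_inj) (negPf ll') mul0r add0r.
by rewrite mderiv_emb ?mulr0 // => j; apply: lam_rho.
Qed.

Lemma left_homog_emb p (h : R) : left_homog p (emb h) <-> homogz p h.
Proof.
have dl m : (\sum_j emnm lam m (lam j))%N = mdeg m.
  by rewrite mdegE; apply: eq_bigr => j _; rewrite emnm_lam.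
have dr m : (\sum_l emnm lam m (rho l))%N = 0%N.
  by rewrite big1 // => l _; rewrite emnm_notin // => j; apply: lam_rho.
split=> [H|/homogzP H m /msupp_emb[m' /H <- ->]]; last by rewrite dl dr.
apply/homogzP => m; rewrite mcoeff_msupp.
by rewrite -(mcoeff_emb lam_inj) -mcoeff_msupp => /H[]; rewrite dl.
Qed.

Lemma left_homog_in_emb p (h : S) : left_homog p h -> emb (retr h) = h.
Proof.
move=> H; apply: in_emb => // m i /H[_ h0] hi.
have [[j ji]|[l <-]] := lam_rho_cover i; first by have := hi j; rewrite ji eqxx.
by move: h0 => /eqP; rewrite eqz_nat sum_nat_eq0 => /forallP/(_ l)/eqP.
Qed.

Lemma pair_rel_emb p (v : 'rV[R]_n) : pair_rel p (map_mx emb v) <->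
  log_vec b b' v /\ forall i, homogz (p - 1) (v 0 i).
Proof.
by split=> -[/pair_sum_emb_eq0 h H]; split=> // i; have := H i;
  rewrite mxE left_homog_emb.
Qed.

(** All [f i] have the same degree 1, so the defining conditions hold degree by degree. *)
Lemma log_vec_pihomog d (v : 'rV[R]_n) : log_vec b b' v ->
  log_vec b b' (map_mx (pihomog mdeg d) v).
Proof.
move=> h l.
transitivity (pihomog mdeg (1 + d) (\sum_i tnth b' l 0 i *: (v 0 i * f i))).
  rewrite raddf_sum /=; apply: eq_bigr => i _.
  rewrite mxE linearZ /= mulrC [v 0 i * _]mulrC.
  by rewrite pihomogM // -homogz_nat homogz_coordform.
by rewrite h pihomog0.
Qed.

Lemma pair_rel_span (u : 'rV[S]_n) :
  (exists2 t : seq 'rV[S]_n, (forall v, v \in t -> exists p, pair_rel p v) &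
    u = \sum_(v <- t) v) <->
  exists2 v, log_vec b b' v & u = map_mx emb v.
Proof.
split=> [[t ht ->]|[v hv ->]].
  have E : \sum_(v <- t) v = map_mx emb (map_mx retr (\sum_(v <- t) v)).
    apply/rowP => i; rewrite !mxE !summxE [retr _]rmorph_sum [RHS]rmorph_sum.
    apply: eq_big_seq => v vt.
    have [p [_ /(_ i) hp]] := ht v vt.
    by rewrite /= (left_homog_in_emb hp).
  exists (map_mx retr (\sum_(v <- t) v)) => //; apply/pair_sum_emb_eq0.
  rewrite -E /pair_sum; under eq_bigr do rewrite summxE mulr_suml.
  rewrite exchange_big big_seq big1 //= => v vt.
  by have [p []] := ht v vt.
(* [msize] exceeds the degree, so the components of degree below [K] add up to [v]. The component of
   degree [d] lies in degree [d + 1] of the kernel, by the degree of the generators. *)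
pose K := (\max_(i < n) msize (v (0%R : 'I_1) i))%N.
exists [seq map_mx emb (map_mx (pihomog mdeg d) v) | d <- index_iota 0 K].
  move=> _ /mapP[d _ ->]; exists (d%:Z + 1); apply/pair_rel_emb; split.
    exact: log_vec_pihomog.
  by move=> i; rewrite addrK mxE homogz_nat pihomogP.
rewrite big_map; apply/rowP => i; rewrite mxE summxE.
rewrite {1}(@pihomog_partitionE _ _ mdeg K (v 0 i)); last exact: leq_bigmax.
rewrite rmorph_sum big_mkord.
by apply: eq_bigr => d _; rewrite !mxE.
Qed.

Variables (U : lmodType R) (gU : int -> U -> Prop) (toP : U -> 'rV[S]_n).
Hypothesis frame : exists X T, dual_frame (tuple_mx b) (tuple_mx b') X T.
Hypothesis f_neq0 : forall i, f i != 0.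
Hypothesis toP_inj : injective toP.
Hypothesis toP_lin : forall a x y, toP (a *: x + y) = emb a *: toP x + toP y.
Hypothesis toP_range : forall u, (exists x, toP x = u) <->
  (exists2 t : seq 'rV[S]_n, (forall v, v \in t -> exists p, pair_rel p v) &
    u = \sum_(v <- t) v).
Hypothesis toP_deg : forall p x, gU p x <-> pair_rel p (toP x).

(** Elements of [U] have entries in the image of [emb], so [retr] turns them into vectors over [R]
    without loss, and [log_der_iso] applies. *)
Lemma pair_rel_der_iso : graded_iso gU (gshift (@der_deg k r n f) (-1)).
Proof.
have [X [T XT]] := frame.
pose chi x := map_mx retr (toP x).
have chi_lin : linear chi.
  move=> a x y; apply/rowP => i.
  by rewrite !mxE toP_lin !mxE [LHS]rmorphD /= [X in X + _]rmorphM /= embK.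
pose chiL : {linear U -> 'rV[R]_n} :=
  HB.pack chi (GRing.isLinear.Build _ _ _ _ chi chi_lin).
have valE x : exists2 v, log_vec b b' v & toP x = map_mx emb v.
  by apply/pair_rel_span/toP_range; exists x.
have embretr (v : 'rV[R]_n) : map_mx retr (map_mx emb v) = v.
  by apply/rowP => i; rewrite !mxE embK.
have chiE x : toP x = map_mx emb (chi x).
  by have [v _ e] := valE x; rewrite /chi e embretr.
apply: (@log_der_iso _ _ _ _ _ _ _ _ XT f_neq0 _ _ chiL).
- by move=> x y /= e; apply: toP_inj; rewrite !chiE e.
- move=> v; split=> [[x <-]|hv].
    by have [w hw e] := valE x; rewrite /= /chi e embretr.
  have [x e] : exists x, toP x = map_mx emb v.
    by apply/toP_range/pair_rel_span; exists v.
  by exists x; rewrite /= /chi e embretr.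
move=> p x; apply: iff_trans (toP_deg p x) _; rewrite chiE.
by apply: iff_trans (pair_rel_emb _ _) _; split=> [[]|h] //; split=> //;
  have [w hw e] := valE x; rewrite /chi e embretr.
Qed.

End PairRelations.

(** * The kernel in bidegrees (p,1), (1,q) and (1,1) *)

Section PairIdeal.
Variables (k : fieldType) (n r s : nat).
Variables (b : r.-tuple 'rV[k]_n) (b' : s.-tuple 'rV[k]_n).
Local Notation f := (coordform b).
Local Notation g := (coordform b').
Local Notation S := {mpoly k[r + s]}.

Lemma lrshift_neq (j : 'I_r) (l : 'I_s) : lshift s j != rshift r l.
Proof. by rewrite eq_lrshift. Qed.

Lemma lrshift_cover (i : 'I_(r + s)) :
  (exists j, lshift s j = i) \/ (exists l, rshift r l = i).
Proof. by case: (split_ordP i) => j ->; [left|right]; exists j. Qed.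

Lemma Kbi_col p (u : 'rV[S]_n) :
  Kbi f g p 1 u <-> pair_rel (@lshift r s) (@rshift r s) b b' p u.
Proof.
split=> -[u0 h]; split=> // i.
  by move=> m mu; have /bihomogP/(_ m mu) := h i; rewrite subrr.
by apply/bihomogP => m /h; rewrite subrr.
Qed.

Lemma Kbi_row q (u : 'rV[S]_n) :
  Kbi f g 1 q u <-> pair_rel (@rshift r s) (@lshift r s) b' b q u.
Proof.
have E : pair_sum (@rshift r s) (@lshift r s) b' b u = Defs.pairmap f g u.
  by apply: eq_bigr => i _; rewrite [X in _ * X]mulrC.
split=> -[u0 h]; split=> [|i].
- by rewrite E.
- by move=> m mu; have /bihomogP/(_ m mu)[] := h i; rewrite subrr.
- by rewrite -E.
- by apply/bihomogP => m /h[]; rewrite subrr.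
Qed.

Lemma Kcol_iso :
  (exists X T, dual_frame (tuple_mx b) (tuple_mx b') X T) ->
  (forall i, f i != 0) ->
  graded_iso (@Kcol_deg k r s n f g 1) (gshift (@der_deg k r n f) (-1)).
Proof.
move=> fr f0.
apply: (@pair_rel_der_iso k r s n (r + s) (@lshift r s) (@rshift r s)
  _ _ _ _ b b' (Kcol f g 1) _ (@kcol_val _ _ _ _ _ _ _)) => //.
- exact: lshift_inj.
- exact: rshift_inj.
- exact: lrshift_neq.
- exact: lrshift_cover.
- exact: val_inj.
- move=> u; split=> [[[x /= /asboolP[t ht ux] <-]]|[t ht ux]].
    by exists t => // v /ht[p /Kbi_col]; exists p.
  have uK : u \in Kcol_pred f g 1.
    by apply/asboolP; exists t => // v /ht[p /Kbi_col]; exists p.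
  by exists (MkKcol uK).
by move=> p x; apply: Kbi_col.
Qed.

Lemma Krow_iso :
  (exists X T, dual_frame (tuple_mx b') (tuple_mx b) X T) ->
  (forall i, g i != 0) ->
  graded_iso (@Krow_deg k r s n f g 1) (gshift (@der_deg k s n g) (-1)).
Proof.
move=> fr g0.
apply: (@pair_rel_der_iso k s r n (r + s) (@rshift r s) (@lshift r s)
  _ _ _ _ b' b (Krow f g 1) _ (@krow_val _ _ _ _ _ _ _)) => //.
- exact: rshift_inj.
- exact: lshift_inj.
- by move=> j l; rewrite eq_sym lrshift_neq.
- by move=> i; case: (lrshift_cover i); [right|left].
- exact: val_inj.
- move=> u; split=> [[[x /= /asboolP[t ht ux] <-]]|[t ht ux]].
    by exists t => // v /ht[p /Kbi_row]; exists p.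
  have uK : u \in Krow_pred f g 1.
    by apply/asboolP; exists t => // v /ht[p /Kbi_row]; exists p.
  by exists (MkKrow uK).
by move=> p x; apply: Kbi_row.
Qed.

(** The entries of [u] have bidegree (0,0), so they are constants, and for constants [log_vec]
    becomes a bilinear condition on the two bases. *)
Lemma Kbi11P (u : 'rV[S]_n) : Kbi f g 1 1 u <->
  exists2 c : 'I_n -> k, u = \row_i (c i)%:MP &
    forall j l, \sum_i c i * tnth b j 0 i * tnth b' l 0 i = 0.
Proof.
have scal (c : 'I_n -> k) :
    \row_i (c i)%:MP_[r + s] = map_mx (emb (@lshift r s)) (\row_i (c i)%:MP).
  by apply/rowP => i; rewrite !mxE embC.
have cond (c : 'I_n -> k) : log_vec b b' (\row_i (c i)%:MP) <->
    forall j l, \sum_i c i * tnth b j 0 i * tnth b' l 0 i = 0.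
  have E l : \sum_i tnth b' l 0 i *: ((\row_i (c i)%:MP) 0 i * f i) =
      \sum_j (\sum_i c i * tnth b j 0 i * tnth b' l 0 i) *: 'X_j.
    under [RHS]eq_bigr do rewrite scaler_suml.
    rewrite exchange_big; apply: eq_bigr => i _.
    rewrite mxE mul_mpolyC scalerA /coordform scaler_sumr.
    apply: eq_bigr => j _.
    by rewrite /= scalerA -mulrA mulrC.
  split=> [h j l|h l]; last by rewrite E big1 // => j _; rewrite h scale0r.
  (* The relation is a linear form; its derivative by ['X_j] is the coefficient of ['X_j]. *)
  have := congr1 (mderiv j) (h l); rewrite E mderiv0 raddf_sum (bigD1 j) //=.
  rewrite mderivZ mderivXU eqxx [X in _ + X]big1 ?addr0 => [|j' jj'].
    by move/eqP; rewrite scaler_eq0 oner_eq0 orbF => /eqP.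
  by rewrite mderivZ mderivXU (negPf jj') scaler0.
split=> [[u0 h]|[c -> h]]; last first.
  rewrite Kbi_col scal pair_rel_emb; first last.
  - exact: lrshift_neq.
  - exact: rshift_inj.
  - exact: lshift_inj.
  split; first exact/cond.
  move=> i; rewrite mxE subrr; apply/homogzP => m; rewrite msuppC.
  by case: ifP => // _; rewrite inE => /eqP ->; rewrite mdeg0.
pose c i := (u 0 i)@_0.
have uc : u = \row_i (c i)%:MP.
  apply/rowP => i; rewrite mxE /c; apply/mpolyP => m; rewrite mcoeffC.
  have [->|m0] := eqVneq m 0%MM; first by rewrite mulr1.
  rewrite mulr0; apply/eqP; rewrite mcoeff_eq0.
  apply: contra m0 => mu; have /bihomogP/(_ m mu) := h i; rewrite subrr.
  (* Both partial degrees of the monomial vanish, so all its exponents do. *)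
  case=> /eqP; rewrite eqz_nat sum_nat_eq0 => /forallP hl.
  move=> /eqP; rewrite eqz_nat sum_nat_eq0 => /forallP hr.
  apply/eqP/mnmP => a; rewrite mnm0E.
  by case: (lrshift_cover a) => -[j <-]; apply/eqP; [exact: hl|exact: hr].
exists c => //; apply/cond.
apply/(pair_sum_emb_eq0 (@lshift_inj r s) (@rshift_inj r s) lrshift_neq).
by rewrite -scal -uc.
Qed.

End PairIdeal.

(** * Bidegree (1,1) and the connected components *)

Lemma bilinear_basis (k : fieldType) (n r s : nat) (U V : {vspace 'rV[k]_n})
    (b : r.-tuple 'rV[k]_n) (b' : s.-tuple 'rV[k]_n) (c : 'I_n -> k) :
  basis_of U b -> basis_of V b' ->
  (forall j l, \sum_i c i * tnth b j 0 i * tnth b' l 0 i = 0) <->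
  (forall x y, x \in U -> y \in V -> \sum_i c i * x 0 i * y 0 i = 0).
Proof.
move=> hb hb'; split=> [h x y|h j l]; last first.
  by apply: h; rewrite ?(basis_mem hb) ?(basis_mem hb') ?mem_tnth.
pose D : 'M[k]_n := diag_mx (\row_i c i).
have E (p q : nat) (F : 'M[k]_(p, n)) (G : 'M[k]_(q, n)) j l :
    (F *m D *m G^T) j l = \sum_i c i * F j i * G l i.
  rewrite mxE; apply: eq_bigr => i _; rewrite mul_mx_diag !mxE.
  by rewrite [F j i * _]mulrC.
have BB : tuple_mx b *m D *m (tuple_mx b')^T = 0.
  apply/matrixP => j l; rewrite E mxE -[RHS](h j l); apply: eq_bigr => i _.
  by rewrite !mxE.
rewrite (mem_tuple_mx _ hb) (mem_tuple_mx _ hb') => /submxP[A ->] /submxP[B ->].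
rewrite -E trmx_mul !mulmxA -(mulmxA A) -(mulmxA A) BB.
by rewrite mulmx0 mul0mx mxE.
Qed.

Section Components.
Variables (k : fieldType) (n r s : nat).
Variables (W : {vspace 'rV[k]_n}) (M : matroid 'I_n).
Hypothesis hW : realizes W M.

Lemma mcomponents_partition : partition (mcomponents M) [set: 'I_n].
Proof.
apply: equivalence_partitionP => x y z _ _ _.
exact: (mconnected_equiv hW).
Qed.

Lemma mem_pblock_mcomponents i j :
  (j \in pblock (mcomponents M) i) = mconnected M i j.
Proof.
rewrite pblock_equivalence_partition ?inE // => x y z _ _ _.
exact: (mconnected_equiv hW).
Qed.

Lemma component_sumE (c : {set 'I_n} -> k) :
  \sum_(C in mcomponents M) (c C)%:MP *: \sum_(i in C) pgen k r s i =
  \row_i (c (pblock (mcomponents M) i))%:MP.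
Proof.
have [/eqP cov triv _] := and3P mcomponents_partition.
transitivity (\sum_i (c (pblock (mcomponents M) i))%:MP *: pgen k r s i).
  rewrite (eq_bigl (fun i => i \in [set: 'I_n])); last by move=> i; rewrite inE.
  rewrite (set_partition_big _ mcomponents_partition) /=.
  apply: eq_bigr => C CM; rewrite scaler_sumr; apply: eq_bigr => i iC.
  by rewrite (def_pblock triv CM iC).
by rewrite [RHS]row_sum_delta; apply: eq_bigr => i _; rewrite mxE.
Qed.

Lemma component_sumP (u : 'rV[{mpoly k[r + s]}]_n) :
  (exists c : {set 'I_n} -> k,
    u = \sum_(C in mcomponents M) (c C)%:MP *: \sum_(i in C) pgen k r s i) <->
  (exists2 c : 'I_n -> k, u = \row_i (c i)%:MP &
    forall i j, mconnected M i j -> c i = c j).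
Proof.
have [/eqP cov triv _] := and3P mcomponents_partition.
have inP i : i \in cover (mcomponents M) by rewrite cov inE.
split=> [[c ->]|[c -> h]].
  exists (fun i => c (pblock (mcomponents M) i)); first exact: component_sumE.
  move=> i j; rewrite -mem_pblock_mcomponents => ij.
  by rewrite (same_pblock triv ij).
(* The value on a block is that at a chosen element, as [c] is constant on components. The default 0
   concerns the empty set, which is not a block. *)
exists (fun C : {set 'I_n} => if [pick i in C] is Some i then c i else 0).
rewrite component_sumE; apply/rowP => i; rewrite !mxE; congr mpolyC.
case: pickP => [j|/(_ i)]; last by rewrite mem_pblock inP.
by rewrite mem_pblock_mcomponents => /h.
Qed.

End Components.

Theorem theorem3p2 (k : fieldType) (n r s : nat) (M : matroid 'I_n)
    (W : {vspace 'rV[k]_n})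
    (b : r.-tuple 'rV[k]_n) (b' : s.-tuple 'rV[k]_n)
    (hM : mrank M = r) (hW : realizes W M)
    (hb : basis_of W b) (hb' : basis_of (perp W) b') :
  let f := coordform b in
  let g := coordform b' in
  (forall u : 'rV[{mpoly k[r + s]}]_n,
     Kbi f g 1 1 u <->
     exists c : {set 'I_n} -> k,
       u = \sum_(C in mcomponents M) (c C)%:MP *: \sum_(i in C) pgen k r s i)
  /\ ((forall i, ~~ mloop M i) ->
      graded_iso (@Kcol_deg k r s n f g 1) (gshift (@der_deg k r n f) (-1)))
  /\ ((forall i, ~~ mcoloop M i) ->
      graded_iso (@Krow_deg k r s n f g 1) (gshift (@der_deg k s n g) (-1))).
Proof.
move=> f g; have [X [T XT]] := dual_frame_exists hb hb'.
split=> [u|]; last split=> h.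
- apply: (iff_trans (Kbi11P b b' u)); apply: iff_sym.
  apply: (iff_trans (component_sumP hW u)).
  split=> -[c uc cP]; exists c => //.
    by apply/(bilinear_basis c hb hb')/(scale_coord_perp hW).
  by apply/(scale_coord_perp hW)/(bilinear_basis c hb hb').
- apply: Kcol_iso; first by exists X, T.
  by move=> i; apply: (coordform_neq0 hb); apply: (nonloop_mem hW).
(* Transposing the frame exchanges [W] and [perp W]; the absence of coloops makes every [g i]
   nonzero. *)
- apply: Krow_iso; first by exists T^T, X^T; apply: dual_frame_sym.
  by move=> i; apply: (coordform_neq0 hb'); apply: (noncoloop_perp hW).
Qed.
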